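(* Let $(a,b,c,d,e,f)$ be any one of the following fifteen 6-tuples: $(1,-1,1,-1,-2,1)$, $(1,-1,1,-2,-1,1)$, $(1,1,-1,-2,1,1)$, $(1,1,2,-2,3,1)$, $(1,-1,3,2,-2,1)$, $(1,-1,3,-2,2,1)$, $(2,-1,-1,1,-6,1)$, $(2,-1,-1,-6,1,1)$, $(1,1,1,-6,-1,2)$, $(2,1,2,-2,5,1)$, $(1,-1,5,-2,2,2)$, $(1,-2,5,2,-2,1)$, $(1,-1,7,-7,2,4)$, $(1,-4,7,2,-7,1)$, $(1,4,-7,2,7,1)$. Then for every non-negative integer $n$ and all integers $m$ and $p$, \[ \sum_{j=0}^n\binom{n}{j}a^jb^{n-j}P_{(m+d)n+p+(c-d)j}=f^nP_{(m+e)n+p}. \]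
   Context: The Padovan numbers $P_n$ are defined for all integers $n$ by $P_0=P_1=P_2=1$ and $P_n=P_{n-2}+P_{n-3}$ for all integers $n$ (extended to negative indices via $P_n=P_{n+3}-P_{n+1}$). The listed tuples are exactly those for which $a\theta^{m+c}+b\theta^{m+d}=f\theta^{m+e}$ holds for every root $\theta$ of $x^3-x-1$ and every integer $m$. *)

(* Defs.v *)
From mathcomp Require Import all_boot all_order all_algebra.
From mathcomp Require Import zify.

Set Implicit Arguments.
Unset Strict Implicit.
Unset Printing Implicit Defensive.

Import GRing.Theory.

Local Open Scope ring_scope.

Fixpoint padovan_pos (n : nat) : int :=
  match n with
  | (k.+1 as k1).+2 => padovan_pos k1 + padovan_pos k
  | _ => 1
  end.

(* [padovan_neg n] is P_{-n}. The values P_0 = 1, P_{-1} = P_2 - P_0 = 0 and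
   P_{-2} = P_1 - P_{-1} = 1 start the recursion P_{-n} = P_{-n+3} - P_{-n+1}. *)
Fixpoint padovan_neg (n : nat) : int :=
  match n with
  | 0 => 1
  | 1 => 0
  | 2 => 1
  | ((k.+1).+1 as k2).+1 => padovan_neg k - padovan_neg k2
  end.

Definition padovan (n : int) : int :=
  match n with
  | Posz k => padovan_pos k
  | Negz k => padovan_neg k.+1
  end.

Lemma padovan0 : padovan 0 = 1. Proof. by []. Qed.
Lemma padovan1 : padovan 1 = 1. Proof. by []. Qed.
Lemma padovan2 : padovan 2 = 1. Proof. by []. Qed.

Lemma padovan_rec (n : int) : padovan n = padovan (n - 2) + padovan (n - 3).
Proof.
case: n => [[|[|[|k]]]|k] //.
  have -> : Posz k.+3 - 2 = Posz k.+1 by lia.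
  by have -> : Posz k.+3 - 3 = Posz k by lia.
have -> : Negz k - 2 = Negz k.+2 by lia.
have -> : Negz k - 3 = Negz k.+3 by lia.
change (padovan_neg k.+1 =
  padovan_neg k.+3 + (padovan_neg k.+1 - padovan_neg k.+3)).
by rewrite addrC subrK.
Qed.

Definition padovan_tuples : seq (int * int * int * int * int * int) :=
  [:: (1, -1, 1, -1, -2, 1);
      (1, -1, 1, -2, -1, 1);
      (1, 1, -1, -2, 1, 1);
      (1, 1, 2, -2, 3, 1);
      (1, -1, 3, 2, -2, 1);
      (1, -1, 3, -2, 2, 1);
      (2, -1, -1, 1, -6, 1);
      (2, -1, -1, -6, 1, 1);
      (1, 1, 1, -6, -1, 2);
      (2, 1, 2, -2, 5, 1);
      (1, -1, 5, -2, 2, 2);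
      (1, -2, 5, 2, -2, 1);
      (1, -1, 7, -7, 2, 4);
      (1, -4, 7, 2, -7, 1);
      (1, 4, -7, 2, 7, 1)].

(* Main.v *)
(** The Padovan sequence is a two-sided solution of u_n = u_(n-2) + u_(n-3), so
    the sequence a P_(k+c) + b P_(k+d) - f P_(k+e), being a solution too, is
    identically zero as soon as it vanishes at k = 0, 1, 2.  In terms of the
    shift operator T, the sum is (a T^c + b T^d)^n and the right-hand side is
    (f T^e)^n, both applied to P at index m n + p. *)
Require Import Defs.
From mathcomp Require Import all_boot all_order all_algebra.
From mathcomp Require Import zify ring.

Import GRing.Theory.

Local Open Scope ring_scope.

Lemma recurrence_eq0 (w : int -> int)
    (w_rec : forall n, w n = w (n - 2) + w (n - 3))
    (w0 : w 0 = 0) (w1 : w 1 = 0) (w2 : w 2 = 0) (n : int) : w n = 0.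
Proof.
have up (k : nat) : [/\ w k%:Z = 0, w (k%:Z + 1) = 0 & w (k%:Z + 2) = 0].
  elim: k => [|k [IH0 IH1 IH2]]; first by split.
  have -> : k.+1%:Z = k%:Z + 1 by lia.
  split=> //; first by rewrite -addrA.
  rewrite w_rec.
  have -> : k%:Z + 1 + 2 - 2 = k%:Z + 1 by lia.
  have -> : k%:Z + 1 + 2 - 3 = k%:Z by lia.
  by rewrite IH0 IH1.
have down (k : nat) : [/\ w (- k%:Z) = 0, w (1 - k%:Z) = 0 & w (2 - k%:Z) = 0].
  elim: k => [|k [IH0 IH1 IH2]]; first by split.
  have -> : 1 - k.+1%:Z = - k%:Z by lia.
  have -> : 2 - k.+1%:Z = 1 - k%:Z by lia.
  split=> //.
  (* Solving the recurrence at [2 - k] for its last term carries the zero window one step down, to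
     index [-(k+1)]. *)
  have := w_rec (2 - k%:Z).
  have -> : 2 - k%:Z - 2 = - k%:Z by lia.
  have -> : 2 - k%:Z - 3 = - k.+1%:Z by lia.
  by rewrite IH2 IH0 add0r => <-.
case: n => k; first by case: (up k).
by rewrite NegzE; case: (down k.+1).
Qed.

(** Integer counterpart of the power identity at the roots of x^3 - x - 1. *)
Lemma padovan_relation (a b c d e f : int) :
  (a, b, c, d, e, f) \in padovan_tuples ->
  forall k, a * padovan (k + c) + b * padovan (k + d) = f * padovan (k + e).
Proof.
pose w (t : int * int * int * int * int * int) (k : int) : int :=
  let: (a, b, c, d, e, f) := t in
  a * padovan (k + c) + b * padovan (k + d) - f * padovan (k + e).
move=> in_t k; apply/eqP; rewrite -subr_eq0; apply/eqP.
have /and3P[/eqP w0 /eqP w1 /eqP w2] :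
    [&& w (a, b, c, d, e, f) 0 == 0, w (a, b, c, d, e, f) 1 == 0
      & w (a, b, c, d, e, f) 2 == 0].
  (* Fifteen tuples at three indices: a finite check by computation. *)
  have : all (fun t => [&& w t 0 == 0, w t 1 == 0 & w t 2 == 0]) padovan_tuples.
    by vm_compute.
  by move/allP/(_ _ in_t).
apply: (recurrence_eq0 (w (a, b, c, d, e, f))) w0 w1 w2 k => n /=.
rewrite (padovan_rec (n + c)) (padovan_rec (n + d)) (padovan_rec (n + e)).
by rewrite !(addrAC n (- _)); ring.
Qed.

(** Pascal's rule. [F] is arbitrary because the summands used below contain [u] at a shifted index
    and are not mere products of powers. *)
Lemma sum_binS (V : nmodType) (F : nat -> nat -> V) (n : nat) :
  \sum_(0 <= j < n.+2) F j (n.+1 - j)%N *+ 'C(n.+1, j) =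
  \sum_(0 <= j < n.+1) (F j.+1 (n - j)%N + F j (n - j).+1) *+ 'C(n, j).
Proof.
under [RHS]eq_bigr do rewrite mulrnDl.
rewrite big_split /= big_nat_recl // bin0 subn0.
under eq_bigr do rewrite binS mulrnDr subSS.
rewrite big_split /= addrA [RHS]addrC; congr (_ + _).
(* The last term on the left vanishes since ['C(n, n.+1)] is 0. *)
rewrite [RHS]big_nat_recl // bin0 subn0 big_nat_recr //= bin_small // addr0.
by congr (_ + _); apply: eq_big_nat => i /andP[_ lt_in]; rewrite subnSK.
Qed.

(** Induction on [n] with [q] free: peeling off one factor moves [q] to [q + c] or [q + d], and
    [u_rel] at [k = q + e * n] recombines the two results. *)
Lemma binomial_shift (u : int -> int) (a b c d e f : int)
    (u_rel : forall k, a * u (k + c) + b * u (k + d) = f * u (k + e))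
    (n : nat) (q : int) :
  \sum_(0 <= j < n.+1)
     (a ^+ j * b ^+ (n - j) * u (q + c * j%:Z + d * (n - j)%N%:Z)) *+ 'C(n, j)
  = f ^+ n * u (q + e * n%:Z).
Proof.
elim: n q => [|n IHn] q.
  by rewrite big_nat1 bin0 !expr0 !mulr0 !addr0 !mul1r.
rewrite (sum_binS _ (fun i j => a ^+ i * b ^+ j * u (q + c * i%:Z + d * j%:Z))).
transitivity (a * (f ^+ n * u (q + c + e * n%:Z))
              + b * (f ^+ n * u (q + d + e * n%:Z))).
  rewrite -!IHn !mulr_sumr -big_split; apply: eq_bigr => j _ /=.
  have -> : q + c * j.+1%:Z + d * (n - j)%N%:Z
            = q + c + c * j%:Z + d * (n - j)%N%:Z by rewrite intS; ring.
  have -> : q + c * j%:Z + d * (n - j).+1%:Z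
            = q + d + c * j%:Z + d * (n - j)%N%:Z by rewrite intS; ring.
  by rewrite !exprS; ring.
have -> : q + e * n.+1%:Z = q + e * n%:Z + e by rewrite intS; ring.
by rewrite exprSr -[RHS]mulrA -u_rel (addrAC q c) (addrAC q d); ring.
Qed.

Theorem theorem14 (a b c d e f : int)
    (Habcdef : (a, b, c, d, e, f) \in padovan_tuples)
    (n : nat) (m p : int) :
  \sum_(0 <= j < n.+1)
     'C(n, j)%:Z * a ^+ j * b ^+ (n - j)
       * padovan ((m + d) * n%:Z + p + (c - d) * j%:Z)
  = f ^+ n * padovan ((m + e) * n%:Z + p).
Proof.
rewrite (_ : (m + e) * n%:Z + p = m * n%:Z + p + e * n%:Z); last by ring.
rewrite -(binomial_shift _ _ _ _ _ _ _ (padovan_relation _ _ _ _ _ _ Habcdef)).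
apply: eq_big_nat => j /andP[_ le_jn].
rewrite -mulr_natl -!mulrA natz; do 3!congr (_ * _); congr padovan.
(* As [j <= n], the truncated [n - j] is the integer difference, so c j + d (n - j) = d n + (c - d)
   j. *)
by rewrite -subzn //; ring.
Qed.
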